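(* Let $n\in\mathbb N$ with $3\mid n$. Then $$\sum_{k=0}^n\binom nk\binom{2k}{k}\frac{u_k(3,3)}{(-4)^k}=0.$$
   Context: For integers $A,B$, the Lucas sequence $u_n=u_n(A,B)$ ($n\in\mathbb N$) is defined by $u_0=0$, $u_1=1$, and $u_{n+1}=Au_n-Bu_{n-1}$ for $n\ge1$. *)

(* Defs.v *)
From mathcomp Require Import all_boot all_order all_algebra.

Set Implicit Arguments.
Unset Strict Implicit.
Unset Printing Implicit Defensive.

Import GRing.Theory.
Local Open Scope ring_scope.

Fixpoint lucas (A B : int) (n : nat) : int :=
  match n with
  | 0%N => 0
  | m.+1 => match m with
            | 0%N => 1
            | k.+1 => A * lucas A B m - B * lucas A B k
            end
  end.

(* Main.v *)
Require Import Defs.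
From mathcomp Require Import all_boot all_order all_algebra.
From mathcomp Require Import algC ring.

Import GRing.Theory Num.Theory.

Local Open Scope ring_scope.

(**
  The sum [g c := \sum_k 'C(n, k) 'C(2k, k) c^k] is the coefficient of [X^n] in
  [(X + c (X + 1)^2)^n].  If [(1 + 4c)(1 + 4c') = 1], substituting [-X] for [X]
  in the base for [c] yields, up to the factor [-(1 + 4c')], the base for [c'],
  so [g c' = (1 + 4c')^n g c].  If [a], [b] are the roots of [x^2 - 3x + 3],
  then [c = -a/4] and [c' = -b/4] satisfy this hypothesis, and
  [1 + 4c' = 1 - b] is a cube root of unity, so [g c = g c'] when [3 | n].
  By Binet's formula the sum in the theorem is [(g c - g c') / (a - b)].
*)

Lemma coef_comp_polyNX (R : comNzRingType) (p : {poly R}) (n : nat) :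
  (p \Po - 'X)`_n = (-1) ^+ n * p`_n.
Proof.
rewrite comp_polyE coef_sum.
under eq_bigr => i _ do
  rewrite exprNn coefZ -polyCN -rmorphXn coefCM coefXn mulrCA mulrA.
have [lt_np|le_pn] := ltnP n (size p).
  rewrite (bigD1 (Ordinal lt_np)) //= eqxx mulr1 big1 ?addr0 // => i.
  by rewrite -val_eqE /= eq_sym => /negPf->; rewrite mulr0.
rewrite [p`_n]nth_default // mulr0 big1 // => i _.
by rewrite gtn_eqF ?mulr0 // (leq_trans (ltn_ord i)).
Qed.

Lemma coef_X1_exp (R : comNzRingType) (m i : nat) :
  (('X + 1 : {poly R}) ^+ m)`_i = 'C(m, i)%:R.
Proof.
rewrite addrC exprDn coef_sum.
under eq_bigr => j _ do rewrite expr1n mul1r coefMn coefXn.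
have [lt_im|lt_mi] := ltnP i m.+1.
  rewrite (bigD1 (Ordinal lt_im)) //= eqxx big1 ?addr0 // => j.
  by rewrite -val_eqE /= eq_sym => /negPf->; rewrite mul0rn.
rewrite bin_small // big1 // => j _.
by rewrite gtn_eqF ?mul0rn // (leq_trans (ltn_ord j)).
Qed.

(** In the binomial expansion of the power, the [k]-th term is a multiple of
    ['X^(n - k) * ('X + 1)^(2k)], whose coefficient at [n] is that of [('X + 1)^(2k)] at [k]. *)
Lemma central_binomial_sumE (R : comNzRingType) (n : nat) (c : R) :
  \sum_(k < n.+1) 'C(n, k)%:R * 'C(2 * k, k)%:R * c ^+ k
  = (('X + c%:P * ('X + 1) ^+ 2) ^+ n)`_n.
Proof.
rewrite exprDn coef_sum; apply: eq_bigr => k _.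
rewrite coefMn exprMn -rmorphXn mulrCA coefCM coefXnM.
have le_kn : (k <= n)%N by rewrite -ltnS.
rewrite ltnNge leq_subr /= subKn // -exprM coef_X1_exp -mulr_natl; ring.
Qed.

Lemma central_binomial_sum_reflect (R : comNzRingType) (n : nat) (c c' : R) :
    c + c' + 4 * c * c' = 0 ->
  \sum_(k < n.+1) 'C(n, k)%:R * 'C(2 * k, k)%:R * c' ^+ k =
  (1 + 4 * c') ^+ n *
  \sum_(k < n.+1) 'C(n, k)%:R * 'C(2 * k, k)%:R * c ^+ k.
Proof.
move=> cc'; rewrite !central_binomial_sumE.
have -> : 'X + c'%:P * ('X + 1) ^+ 2 =
    (- (1 + 4 * c'))%:P * (('X + c%:P * ('X + 1) ^+ 2) \Po - 'X).
  have cc'P : c%:P + c'%:P + 4 * c%:P * c'%:P = 0.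
    by rewrite -[RHS](congr1 polyC cc') !rmorphD !rmorphM /= rmorph_nat.
  rewrite comp_polyD comp_polyM rmorphXn /= comp_polyD comp_polyX -polyC1.
  rewrite !comp_polyC rmorphN rmorphD rmorphM /= rmorph_nat polyC1.
  (* The difference of the two sides is [('X - 1) ^+ 2] times the left side of [cc'P]. *)
  apply: subr0_eq; rewrite -[RHS](mul0r (('X - 1) ^+ 2)) -cc'P; ring.
(* The sign [(-1) ^+ n] from substituting [- 'X] cancels the one from the factor
   [- (1 + 4 * c')]. *)
rewrite exprMn -rmorphXn coefCM -rmorphXn coef_comp_polyNX mulrA -exprMn.
by rewrite mulrN1 opprK.
Qed.

(** Multiplying by [a - b] instead of dividing keeps the formula valid in any commutative ring. *)
Lemma lucas_Binet (R : comNzRingType) (A B : int) (a b : R) (k : nat) :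
    a + b = A%:~R -> a * b = B%:~R ->
  (a - b) * (lucas A B k)%:~R = a ^+ k - b ^+ k.
Proof.
move=> sab mab.
suff [] : (a - b) * (lucas A B k)%:~R = a ^+ k - b ^+ k /\
    (a - b) * (lucas A B k.+1)%:~R = a ^+ k.+1 - b ^+ k.+1 by [].
elim: k => [|k [IH0 IH1]]; first by rewrite mulr0 !expr0 subrr mulr1 !expr1.
split=> //.
have -> : lucas A B k.+2 = A * lucas A B k.+1 - B * lucas A B k by [].
rewrite rmorphB !rmorphM /= mulrBr mulrCA IH1 mulrCA IH0 -sab -mab !exprS.
ring.
Qed.

Theorem theorem1p6 (n : nat) (hn : (3 %| n)%N) :
  \sum_(0 <= k < n.+1)
    ('C(n, k)%:R * 'C(2 * k, k)%:R * (lucas 3 3 k)%:~R / (- 4%:R) ^+ k) = 0 :> rat.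
Proof.
(* The discriminant of [x^2 - 3x + 3] is [-3]. *)
pose s : algC := sqrtC (- 3); have ss : s ^+ 2 = - 3 by rewrite sqrtCK.
have s0 : s != 0 by rewrite sqrtC_eq0 oppr_eq0 pnatr_eq0.
pose a := (3 + s) / 2; pose b := (3 - s) / 2.
have sab : a + b = (3 : int)%:~R by rewrite /a /b; field.
have mab : a * b = (3 : int)%:~R.
  have -> : a * b = (9 - s ^+ 2) / 4 by rewrite /a /b; field.
  by rewrite ss; field.
have dab : a - b = s by rewrite /a /b; field.
have b3 : (1 - b) ^+ 3 = 1.
  have -> : (1 - b) ^+ 3 = (- 1 + 3 * s - 3 * s ^+ 2 + s ^+ 2 * s) / 8.
    by rewrite /b; field.
  by rewrite ss; field.
pose g c : algC := \sum_(k < n.+1) 'C(n, k)%:R * 'C(2 * k, k)%:R * c ^+ k.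
have gE : g (- b / 4) = g (- a / 4).
  rewrite /g (@central_binomial_sum_reflect _ n (- a / 4)); last first.
    (* The reflection hypothesis holds because [a + b] and [a * b] are both [3]. *)
    have -> : - a / 4 + - b / 4 + 4 * (- a / 4) * (- b / 4)
      = (a * b - (a + b)) / 4 by field.
    by rewrite sab mab subrr mul0r.
  have -> : 1 + 4 * (- b / 4) = 1 - b by field.
  by case/dvdnP: hn => m ->; rewrite mulnC exprM b3 expr1n mul1r.
(* The sum is moved to [algC] and multiplied by [s = a - b], so that Binet's formula applies
   termwise. *)
apply/eqP; rewrite -(fmorph_eq0 (ratr : rat -> algC)) -(mulrI_eq0 _ (mulfI s0)).
apply/eqP; rewrite big_mkord rmorph_sum mulr_sumr.
transitivity (g (- a / 4) - g (- b / 4)); last by rewrite gE subrr.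
rewrite /g -sumrB; apply: eq_bigr => k _.
rewrite fmorph_div !rmorphM rmorphXn rmorphN /= !ratr_nat ratr_int.
have /= L := @lucas_Binet _ _ _ _ _ k sab mab; rewrite dab in L.
rewrite [LHS]mulrA [s * _]mulrCA L -mulrBr -mulrA; congr (_ * _).
by rewrite !mulNr -!mulrN -invrN !exprMn !exprVn mulrBl.
Qed.
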